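(* Let $d\ge 1$ be an integer. A subset $M\subset\mathcal{M}_1(\mathfrak{P}(\mathbb{R}^d))$ is regular if and only if for every $x\in\mathbb{R}^d$ and $R>0$ we have $$\lim_{N\to\infty}\sup_{\mu\in M}\mu\big(\{\Gamma\in\mathfrak{P}(\mathbb{R}^d) : N^\Gamma_{r,R}(x)\ge N\}\big)=o(r^{d-1}),\qquad\text{as } r\to 0.$$
   Context: $\mathbb{R}^d$ carries the Euclidean metric, denoted $|x-y|$; below $\mathcal{X}=\mathbb{R}^d$. Curves: $\mathcal{P}=\mathcal{P}(\mathcal{X})$ is the set of compact curves, i.e. continuous maps $\gamma:I^\gamma\to\mathcal{X}$ from a compact interval $I^\gamma$, up to reparametrization, with the metric $d_{\mathcal{P}}(\gamma,\eta)=\inf_\sigma\sup_{t\in I^\gamma}|\gamma(t)-\eta(\sigma(t))|$, the infimum being over increasing homeomorphisms $\sigma:I^\gamma\to I^\eta$ (curves at $d_{\mathcal{P}}$-distance $0$ are identified). Path collections: $\mathfrak{P}=\mathfrak{P}(\mathcal{X})$ is the set of countable multisets $\Gamma$ of elements of $\mathcal{P}$ such that for each $\delta>0$ the multiset $\Gamma(\delta):=\{\gamma\in\Gamma : \mathrm{diam}(\gamma)>\delta\}$ is finite and $\Gamma=\bigcup_{\delta>0}\Gamma(\delta)$ (so there are no constant paths). A matching between $\Gamma,\tilde\Gamma\in\mathfrak{P}$ is a set $\pi\subset\Gamma\times\tilde\Gamma$ such that the projections $\pi\to\Gamma$ and $\pi\to\tilde\Gamma$ are injective; $\Gamma^\pi\subset\Gamma$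 and $\tilde\Gamma^\pi\subset\tilde\Gamma$ denote the elements not contained in any pair of $\pi$. The metric on $\mathfrak{P}$ is $$d_{\mathfrak{P}}(\Gamma,\tilde\Gamma)=\inf_\pi\max\Big(\sup_{(\gamma,\tilde\gamma)\in\pi}d_{\mathcal{P}}(\gamma,\tilde\gamma),\ \sup_{\gamma\in\Gamma^\pi}\mathrm{diam}(\gamma),\ \sup_{\tilde\gamma\in\tilde\Gamma^\pi}\mathrm{diam}(\tilde\gamma)\Big),$$ the infimum being over all matchings $\pi$ (a supremum over the empty set is $0$). Crossings: for $x\in\mathcal{X}$ and $0<r<R<\infty$ let $A_{r,R}(x)=\{y\in\mathcal{X} : r<|x-y|<R\}$. For a curve $\gamma:I\to\mathcal{X}$, $A^\gamma_{r,R}(x)$ is the set of intervals $(a,b)\subset I$ such that $\gamma((a,b))\subset A_{r,R}(x)$ and $\{|x-\gamma(a)|,|x-\gamma(b)|\}=\{r,R\}$; $N^\gamma_{r,R}(x):=|A^\gamma_{r,R}(x)|$ (independent of the parametrization), and $N^\Gamma_{r,R}(x):=\sum_{\gamma\in\Gamma}N^\gamma_{r,R}(x)$ for $\Gamma\in\mathfrak{P}$. $\mathcal{M}_1(\mathfrak{P})$ is the set of Borel probability measures on $(\mathfrak{P},d_{\mathfrak{P}})$. A subset $M\subset\mathcal{M}_1(\mathfrak{P})$ is regular if for every $x\in\mathcal{X}$ and every $R>r>0$, $$\lim_{N\to\infty}\sup_{\mu\in M}\mu\big(\{\Gamma\in\mathfrak{P} : N^\Gamma_{r,R}(x)\ge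 N\}\big)=0.$$ *)

(* Defs.v *)
From HB Require Import structures.
From mathcomp Require Import all_boot all_order all_algebra.
From mathcomp Require Import generic_quotient.
From mathcomp Require Import all_classical all_reals all_analysis.
From mathcomp Require Import lra.

Set Implicit Arguments.
Unset Strict Implicit.
Unset Printing Implicit Defensive.

Import Order.TTheory GRing.Theory Num.Theory.
Import numFieldNormedType.Exports.

Local Open Scope classical_set_scope.
Local Open Scope ring_scope.
Local Open Scope quotient_scope.

(* The library's norm on ['rV[R]_d] is the sup norm, hence this definition; the
   topology is the same. *)
Definition edist (R : realType) (d : nat) (x y : 'rV[R]_d) : R :=
  Num.sqrt (\sum_(i < d) (x 0 i - y 0 i) ^+ 2).

(* Supremum in [0, +oo], so that the supremum of the empty set is 0 (it is -oo
   for [ereal_sup]). *)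
Definition sup0 (R : realType) (A : set (\bar R)) : \bar R :=
  ereal_sup (0%E |` A).

Section Curves.
Context {R : realType} {d : nat}.
Local Notation E := 'rV[R]_d.

(* A parametrized curve; only the values on [lo, hi] are meaningful, the others
   are forgotten in the quotient [curve] below. *)
Record pcurve := PCurve {
  lo : R;
  hi : R;
  lo_lt_hi : lo < hi;
  pcurve_fun :> R -> E;
  pcurve_continuous : {within `[lo, hi], continuous pcurve_fun} }.

Definition pcurve_dom (g : pcurve) : set R := `[lo g, hi g].

Definition incr_homeo (I J : set R) (s : R -> R) : Prop :=
  {in I &, {homo s : x y / x < y}} /\
  exists t : R -> R,
    [/\ set_fun I J s /\ set_fun J I t,
        {in I, cancel s t} /\ {in J, cancel t s},
        {within I, continuous s} & {within J, continuous t}].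

Definition pcurve_dist (g h : pcurve) : \bar R :=
  ereal_inf [set ereal_sup [set (edist (g t) (h (s t)))%:E | t in pcurve_dom g]
            | s in incr_homeo (pcurve_dom g) (pcurve_dom h)].

Definition pcurve_diam (g : pcurve) : \bar R :=
  ereal_sup [set (edist (g p.1) (g p.2))%:E | p in pcurve_dom g `*` pcurve_dom g].

(* An interval (a, b) is encoded by the pair of its end points. *)
Definition pcurve_crossings (g : pcurve) (x : E) (r r' : R) : set (R * R) :=
  [set p | [/\ pcurve_dom g p.1 /\ pcurve_dom g p.2, p.1 < p.2,
     (forall t, p.1 < t < p.2 -> r < edist x (g t) < r') &
     [set edist x (g p.1); edist x (g p.2)] = [set r; r']]].

Definition pcurve_ncross (g : pcurve) (x : E) (r r' : R) : \bar R :=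
  counting (pcurve_crossings g x r r').

Definition pcurve_eqv (g h : pcurve) : bool := `[< pcurve_dist g h = 0%E >].

HB.instance Definition _ := gen_eqMixin pcurve.
HB.instance Definition _ := gen_choiceMixin pcurve.

Lemma edist_ge0 (x y : E) : 0 <= edist x y.
Proof. exact: sqrtr_ge0. Qed.

Lemma edistxx (x : E) : edist x x = 0.
Proof.
by rewrite /edist big1 ?sqrtr0// => i _; rewrite subrr expr0n.
Qed.

Lemma edistC (x y : E) : edist x y = edist y x.
Proof.
by congr Num.sqrt; apply: eq_bigr => i _; rewrite -sqrrN opprB.
Qed.

Lemma sqr_edist (x y : E) : edist x y ^+ 2 = \sum_(i < d) (x 0 i - y 0 i) ^+ 2.
Proof. by rewrite sqr_sqrtr// sumr_ge0// => i _; exact: sqr_ge0. Qed.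

Lemma edist_le2 (x y z : E) e : edist x y <= e -> edist y z <= e ->
  edist x z <= e *+ 2.
Proof.
move=> xy yz; have e0 : 0 <= e := le_trans (edist_ge0 x y) xy.
rewrite -(@ler_sqr _ (edist x z)) ?nnegrE ?edist_ge0 ?mulrn_wge0//.
rewrite (@le_trans _ _ (edist x y ^+ 2 *+ 2 + edist y z ^+ 2 *+ 2))//.
  rewrite !sqr_edist -!mulrnDl -big_split/= -sumrMnl ler_sum// => i _.
  have := sqr_ge0 ((x 0 i - y 0 i) - (y 0 i - z 0 i)); nra.
move: xy yz; rewrite -(@ler_sqr _ (edist x y)) ?nnegrE ?edist_ge0// => xy.
rewrite -(@ler_sqr _ (edist y z)) ?nnegrE ?edist_ge0// => yz.
rewrite mulr2n; nra.
Qed.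

Lemma pcurve_dom_lo g : pcurve_dom g (lo g).
Proof. by rewrite /pcurve_dom/= in_itv/= lexx ltW// lo_lt_hi. Qed.

Lemma pcurve_dist_ge0 g h : (0 <= pcurve_dist g h)%E.
Proof.
apply: le_ereal_inf_tmp => _ [s _ <-]; apply: le_ereal_sup_tmp.
by exists (edist (g (lo g)) (h (s (lo g))))%:E;
  [exists (lo g) => //; exact: pcurve_dom_lo|rewrite lee_fin edist_ge0].
Qed.

Lemma pcurve_dist0P g h : pcurve_dist g h = 0%E <->
  forall e, 0 < e -> exists2 s, incr_homeo (pcurve_dom g) (pcurve_dom h) s &
    forall t, pcurve_dom g t -> edist (g t) (h (s t)) <= e.
Proof.
split=> [gh0 e e0|H].
  have : (pcurve_dist g h < e%:E)%E by rewrite gh0 lte_fin.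
  move=> /ereal_inf_lt[_ [s hs <-]] /ltW ge; exists s => // t gt.
  by rewrite -lee_fin (le_trans _ ge)//; apply: ereal_sup_ubound; exists t.
apply/eqP; rewrite eq_le pcurve_dist_ge0 andbT; apply/lee_addgt0Pr => e e0.
have [s hs H'] := H _ e0; rewrite add0e; apply: ge_ereal_inf.
eexists; first by exists s.
by apply: ge_ereal_sup => _ [t gt <-]; rewrite lee_fin H'.
Qed.

Lemma pcurve_eqv_refl : reflexive pcurve_eqv.
Proof.
move=> g; apply/asboolP/pcurve_dist0P => e e0; exists id; last first.
  by move=> t _; rewrite edistxx ltW.
have cid : {within pcurve_dom g, continuous (@idfun R)}.
  by apply/subspace_continuousP => x _; exact: cvg_within.
split; first by move=> x y _ _.
by exists id; split=> //; split=> x.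
Qed.

Lemma pcurve_eqv_sym : symmetric pcurve_eqv.
Proof.
suff H g h : pcurve_eqv g h -> pcurve_eqv h g by move=> g h; apply/idP/idP => /H.
move=> /asboolP/pcurve_dist0P gh; apply/asboolP/pcurve_dist0P => e e0.
have [s [sm [t [[sf tf] [st ts] sc tc]]] gh'] := gh _ e0.
exists t; last first.
  move=> u hu; rewrite edistC -[X in h X]ts ?inE//; apply: gh'; exact: tf.
split; last by exists s; split.
move=> x y; rewrite !inE => hx hy xy.
have [//|] := ltP (t x) (t y); rewrite le_eqVlt => /predU1P[tyx|tyx].
  by move: xy; rewrite -(ts x) ?inE// -(ts y) ?inE// tyx ltxx.
have := sm _ _ _ _ tyx; rewrite !inE !ts ?inE//.
by move=> /(_ (tf _ hy) (tf _ hx)) /(lt_trans xy); rewrite ltxx.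
Qed.

Lemma within_comp (I J : set R) (s t : R -> R) : set_fun I J s ->
  {within I, continuous s} -> {within J, continuous t} ->
  {within I, continuous (t \o s)}.
Proof.
move=> sIJ /subspace_continuousP sc /subspace_continuousP tc.
apply/subspace_continuousP => x Ix U.
move=> /(tc _ (sIJ _ Ix)) /(sc _ Ix); rewrite /= /within/= !nbhs_simpl/=.
by apply: filterS => y /= H Iy; exact: H Iy (sIJ _ Iy).
Qed.

Lemma pcurve_eqv_trans : transitive pcurve_eqv.
Proof.
move=> h g k /asboolP/pcurve_dist0P gh /asboolP/pcurve_dist0P hk.
apply/asboolP/pcurve_dist0P => e e0.
have e20 : 0 < e / 2 by rewrite divr_gt0.
have [s [sm [s' [[sf s'f] [ss' s's] sc s'c]]] ghs] := gh _ e20.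
have [t [tm [t' [[tf t'f] [tt' t't] tc t'c]]] hkt] := hk _ e20.
exists (t \o s); last first.
  move=> u gu; rewrite [e](_ : _ = (e / 2) *+ 2); last by lra.
  by apply: edist_le2 (ghs _ gu) (hkt _ _); exact: sf.
split.
  move=> x y; rewrite !inE => gx gy xy /=.
  by apply: tm; rewrite ?inE; [exact: sf|exact: sf|apply: sm; rewrite ?inE].
exists (s' \o t'); split.
- by split=> x hx /=; [apply/tf/sf|apply/s'f/t'f].
- split=> x; rewrite inE => hx /=.
    by rewrite tt' ?ss' ?inE//; exact: sf.
  by rewrite s's ?t't ?inE//; exact: t'f.
- exact: within_comp sf sc tc.
- exact: within_comp t'f t'c s'c.
Qed.

Canonical pcurve_equiv :=
  EquivRel pcurve_eqv pcurve_eqv_refl pcurve_eqv_sym pcurve_eqv_trans.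

End Curves.

(* Curves up to reparametrization. The notions below are computed on the chosen
   representative [repr c]; they do not depend on it. *)
Definition curve (R : realType) (d : nat) := {eq_quot (@pcurve_equiv R d)}.

HB.instance Definition _ (R : realType) (d : nat) := Choice.on (curve R d).

Section PathCollections.
Context {R : realType} {d : nat}.
Local Notation E := 'rV[R]_d.
Local Notation curve := (curve R d).

Definition curve_dist (c c' : curve) : \bar R :=
  pcurve_dist (repr c) (repr c').

Definition curve_diam (c : curve) : \bar R := pcurve_diam (repr c).

Definition curve_ncross (c : curve) (x : E) (r r' : R) : \bar R :=
  pcurve_ncross (repr c) x r r'.

Definition msupport (m : curve -> nat) : set curve := [set c | (0 < m c)%N].

Definition msupport_gt (m : curve -> nat) (delta : R) : set curve :=
  msupport m `&` [set c | (delta%:E < curve_diam c)%E].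

(* A countable multiset is given by its multiplicity function. Multiplicities
   are finite because each multiset of the elements of diameter larger than
   delta is finite. *)
Record path_coll := PathColl {
  mult :> curve -> nat;
  mult_countable : countable (msupport mult);
  mult_finite : forall delta : R, 0 < delta ->
    finite_set (msupport_gt mult delta);
  mult_nonconstant :
    msupport mult = \bigcup_(delta in [set e : R | 0 < e])
                      msupport_gt mult delta }.

Let pc0 (c : curve) : nat := 0%N.

Let supp_pc0 : msupport pc0 = set0. Proof. by apply/seteqP; split. Qed.

Let supp_gt_pc0 delta : msupport_gt pc0 delta = set0.
Proof. by rewrite /msupport_gt supp_pc0 set0I. Qed.

Program Definition path_coll0 : path_coll := @PathColl pc0 _ _ _.
Next Obligation. by rewrite supp_pc0; exact: countable0. Qed.
Next Obligation. by move=> delta _; rewrite supp_gt_pc0; exact: finite_set0. Qed.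
Next Obligation.
by rewrite supp_pc0 bigcup0// => delta _; exact: supp_gt_pc0.
Qed.

HB.instance Definition _ := gen_eqMixin path_coll.
HB.instance Definition _ := gen_choiceMixin path_coll.
HB.instance Definition _ := isPointed.Build path_coll path_coll0.

(* The elements of the multiset: (c, i) is the i-th copy of c. *)
Definition elements (G : path_coll) : set (curve * nat) :=
  [set q | (q.2 < G q.1)%N].

Definition matching (G G' : path_coll)
    (pi : set ((curve * nat) * (curve * nat))) : Prop :=
  [/\ pi `<=` elements G `*` elements G',
      {in pi &, injective fst} & {in pi &, injective snd}].

Definition matching_cost (G G' : path_coll)
    (pi : set ((curve * nat) * (curve * nat))) : \bar R :=
  maxe (sup0 [set curve_dist p.1.1 p.2.1 | p in pi])
    (maxe (sup0 [set curve_diam q.1 | q in elements G `\` (fst @` pi)])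
          (sup0 [set curve_diam q.1 | q in elements G' `\` (snd @` pi)])).

Definition path_coll_dist (G G' : path_coll) : \bar R :=
  ereal_inf [set matching_cost G G' pi | pi in matching G G'].

(* This is not packed as a library metric space because [path_coll_dist]
   satisfies the triangle inequality only up to a factor 2: for the segments
   c = [-1, 1] and c' = [-1/2, 1/2] of a line, the distances between {c} and
   {c'}, {c'} and path_coll0, {c} and path_coll0 are 1/2, 1, 2. Open sets and
   hence the Borel sets are those of the neighborhoods given by the balls. *)
Definition path_coll_open (U : set path_coll) : Prop :=
  forall G, U G -> exists2 e : R, 0 < e &
    forall G', (path_coll_dist G G' < e%:E)%E -> U G'.

Definition ncross (G : path_coll) (x : E) (r r' : R) : \bar R :=
  \esum_(c in [set: curve]) ((G c)%:R%:E * curve_ncross c x r r')%E.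

Definition path_measure : Type :=
  probability (g_sigma_algebraType path_coll_open) R.

Definition sup_tail (M : set path_measure) (x : E) (r r' : R) (n : nat) :
    \bar R :=
  sup0 [set mu [set G : path_coll | (n%:R%:E <= ncross G x r r')%E]
       | mu in M].

Definition regular (M : set path_measure) : Prop :=
  forall (x : E) (r r' : R), 0 < r -> r < r' ->
    sup_tail M x r r' @ \oo --> 0%E.

End PathCollections.

Arguments path_coll : clear implicits.
Arguments path_measure : clear implicits.

(* Main.v *)
(* For the converse direction, each crossing of the annulus A_{r,R}(x) moves some
   coordinate by at least (R - r) / d, hence meets one of finitely many cubes
   lying in coordinate hyperplanes. These cubes have dimension d - 1, so, given
   any gauge rho(y) > 0, they can be covered by finitely many balls B(y_i, rho_i)
   with rho_i < rho(y_i) and with sum of the rho_i ^ (d - 1) bounded by a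
   constant independent of the gauge (Cousin's lemma by bisection). A crossing
   that meets B(y_i, rho_i) contains a crossing of A_{rho_i,s}(y_i), where
   s = (R - r) / 2, so the limiting tail at (x, r, R) is at most the sum of the
   limiting tails at (y_i, rho_i, s). Choosing the gauge such that the latter are
   at most eps * rho_i ^ (d - 1) bounds it by eps times a constant. The hypothesis
   is thus only needed pointwise in y, without uniformity.

   Union bounds need the events {N >= n} to be measurable: they are closed,
   because the number of crossings is upper semicontinuous. *)
Require Import Defs.
From mathcomp Require Import all_boot all_order all_algebra.
From mathcomp Require Import all_classical all_reals all_analysis.
From mathcomp Require Import finmap lra ring.

Set Implicit Arguments.
Unset Strict Implicit.
Unset Printing Implicit Defensive.

Import Order.TTheory GRing.Theory Num.Theory.
Import numFieldNormedType.Exports.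
(* [all_analysis] exports another [edist]. *)
Import Defs.

Local Open Scope classical_set_scope.
Local Open Scope ring_scope.

(** * Triangle inequality, comparison with coordinates, continuity of the distance *)

Section EuclideanDistance.
Context {R : realType} {d : nat}.
Implicit Types x y z : 'rV[R]_d.

Lemma edist0_eq x y : edist x y = 0 -> x = y.
Proof.
move=> xy0; have /eqP := sqr_edist x y.
rewrite xy0 expr0n/= eq_sym psumr_eq0 => [/allP xyE|i _]; last exact: sqr_ge0.
apply/rowP => i; have := xyE i (mem_index_enum _).
by rewrite sqrf_eq0 subr_eq0 => /eqP.
Qed.

(** In each coordinate, [(p + q) ^+ 2 <= (1 + b / a) * p ^+ 2 + (1 + a / b) * q ^+ 2], the
    difference being [(b * p - a * q) ^+ 2 / (a * b)]. With [a] and [b] the two distances on the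
    right, the bounds add up to [(a + b) ^+ 2]. *)
Lemma edist_triangle x y z : edist x z <= edist x y + edist y z.
Proof.
have [/edist0_eq ->|xy0] := eqVneq (edist x y) 0; first by rewrite edistxx add0r.
have [/edist0_eq ->|yz0] := eqVneq (edist y z) 0; first by rewrite edistxx addr0.
set a := edist x y in xy0 *; set b := edist y z in yz0 *.
have a0 : 0 < a by rewrite lt_neqAle eq_sym xy0 edist_ge0.
have b0 : 0 < b by rewrite lt_neqAle eq_sym yz0 edist_ge0.
rewrite -ler_sqr ?nnegrE ?edist_ge0 ?addr_ge0 ?edist_ge0// sqr_edist.
rewrite (_ : (a + b) ^+ 2 = (1 + b / a) * a ^+ 2 + (1 + a / b) * b ^+ 2); last first.
  by field; rewrite xy0 yz0.
rewrite !sqr_edist !mulr_sumr -big_split/= ler_sum// => i _.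
set u := x 0 i; set v := y 0 i; set w := z 0 i.
rewrite -subr_ge0.
rewrite (_ : _ - _ = (b * (u - v) - a * (v - w)) ^+ 2 / (a * b)).
  by rewrite divr_ge0 ?sqr_ge0// mulr_ge0// ltW.
by field; rewrite xy0 yz0.
Qed.

Lemma coord_le_edist x y i : `|x 0 i - y 0 i| <= edist x y.
Proof.
rewrite -ler_sqr ?nnegrE ?edist_ge0// sqr_edist real_normK ?num_real//.
by rewrite (bigD1 i)//= lerDl sumr_ge0// => j _; exact: sqr_ge0.
Qed.

Lemma edist_le_coord x y (l : R) : 0 <= l ->
  (forall i, `|x 0 i - y 0 i| <= l) -> edist x y <= d%:R * l.
Proof.
move=> l0 H; rewrite -ler_sqr ?nnegrE ?edist_ge0 ?mulr_ge0// sqr_edist.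
have -> : (d%:R * l) ^+ 2 = \sum_(i < d) (d%:R * l ^+ 2).
  by rewrite sumr_const card_ord -mulr_natl exprMn; ring.
apply: ler_sum => i _.
rewrite -[leLHS]real_normK ?num_real//.
apply: (@le_trans _ _ (l ^+ 2)); first by rewrite ler_sqr ?nnegrE.
by rewrite ler_peMl ?sqr_ge0// ler1n (leq_ltn_trans _ (ltn_ord i)).
Qed.

Lemma continuous_edist x : continuous (edist x).
Proof.
have sum_cont : continuous (fun z => \sum_(i < d) (x 0 i - z 0 i) ^+ 2).
  apply: (@continuous_big R _ +%R 0 xpredT (@add_continuous R)) => i _ z.
  apply: (@continuous_comp _ _ _ (fun z => x 0 i - z 0 i) (fun t => t ^+ 2)).
    apply: (@continuousB _ _ _ (fun=> x 0 i) (fun z : 'rV[R]_d => z 0 i)).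
      exact: cst_continuous.
    exact: coord_continuous.
  exact: exprn_continuous.
move=> y; apply: (continuous_comp (sum_cont y)); exact: sqrt_continuous.
Qed.

End EuclideanDistance.

(** * Level crossings of continuous real functions *)

Section RealCrossings.
Context {R : realType}.
Implicit Types (u : R -> R) (a b c r : R).

(** The set of times in [[a, b]] with [u t <= c] is closed, so it contains its supremum. There [u]
    cannot be below [c], since by the intermediate value theorem the value [c] would be taken again
    later. *)
Lemma last_time u a b c : a <= b -> continuous u -> u a <= c -> c <= u b ->
  exists t, [/\ a <= t <= b, u t = c & forall s, t < s -> s <= b -> c < u s].
Proof.
move=> ab uc ua ub.
pose A := [set t | a <= t <= b /\ u t <= c].
have Aa : A a by split=> //; rewrite lexx ab.
have Asup : has_sup A by split; [exists a|exists b => t [/andP[]]].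
have Acl : closed A.
  have -> : A = `[a, b]%classic `&` u @^-1` [set y | y <= c].
    by apply/seteqP; split=> t; rewrite /A /= in_itv.
  apply: closedI; first exact: itv_closed.
  by apply: closed_comp => [t _|]; [exact: uc|exact: closed_le].
have [/andP[at_ tb] utc] : A (sup A).
  by case: Asup => *; apply: Acl; exact: closure_sup.
have after s : sup A < s -> s <= b -> c < u s.
  move=> ts sb; rewrite ltNge; apply/negP => usc.
  have : s <= sup A.
    by apply: ub_le_sup; [exact: Asup.2|split=> //; rewrite sb (le_trans at_ (ltW ts))].
  by rewrite leNgt ts.
exists (sup A); split=> //; first by rewrite at_.
apply/eqP; rewrite eq_le utc/= leNgt; apply/negP => utlt.
have [] := @IVT R u (sup A) b c tb.
- exact: continuous_subspaceT.
- by rewrite ge_min utc/= le_max ub orbT.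
move=> s; rewrite in_itv/= => /andP[ts sb] usc.
move: ts; rewrite le_eqVlt => /predU1P[ts|/after/(_ sb)].
  by move: utlt; rewrite ts usc ltxx.
by rewrite usc ltxx.
Qed.

Lemma first_time u a b c : a <= b -> continuous u -> u a <= c -> c <= u b ->
  exists t, [/\ a <= t <= b, u t = c & forall s, a <= s -> s < t -> u s < c].
Proof.
move=> ab uc ua ub.
have vc : continuous (fun t => - u (- t)).
  move=> t; apply: cvgN; apply: (@continuous_comp _ _ _ -%R u t); last exact: uc.
  exact: opp_continuous.
have [] := @last_time (fun t => - u (- t)) (- b) (- a) (- c) _ vc.
- by rewrite lerN2.
- by rewrite opprK lerN2.
- by rewrite opprK lerN2.
move=> t [/andP[bt ta] /eqP utc after]; exists (- t); split.
- by rewrite lerNr ta lerNl bt.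
- by rewrite -[LHS]opprK (eqP utc) opprK.
move=> s as_ st; have := after (- s); rewrite opprK ltrN2; apply.
  by rewrite ltrNr.
by rewrite lerN2.
Qed.

(** [p] is the last time at level [r], and [q] the first time after [p] at level [r']. *)
Lemma upcrossing u a b r r' : a <= b -> continuous u -> r < r' ->
  u a <= r -> r' <= u b ->
  exists p q, [/\ a <= p, p < q, q <= b, u p = r /\ u q = r' &
    forall t, p < t < q -> r < u t < r'].
Proof.
move=> ab uc rr' ua ub.
have [p [/andP[ap pb] up pafter]] :=
  last_time ab uc ua (le_trans (ltW rr') ub).
have upr' : u p <= r' by rewrite up ltW.
have [q [/andP[pq qb] uq qbefore]] := first_time pb uc upr' ub.
exists p, q; split=> //.
  rewrite lt_neqAle pq andbT; apply/eqP => pqE.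
  by move: rr'; rewrite -up -uq pqE ltxx.
move=> t /andP[pt tq]; rewrite pafter ?(le_trans (ltW tq))//=.
by rewrite qbefore// ltW.
Qed.

Definition traverses u a b r r' :=
  (u a <= r /\ r' <= u b) \/ (r' <= u a /\ u b <= r).

Lemma crossing u a b r r' : a <= b -> continuous u -> r < r' ->
  traverses u a b r r' ->
  exists p q, [/\ a <= p, p < q, q <= b, [set u p; u q] = [set r; r'] &
    forall t, p < t < q -> r < u t < r'].
Proof.
move=> ab uc rr' [[ua ub]|[ua ub]].
  have [p [q [ap pq qb [up uq] H]]] := upcrossing ab uc rr' ua ub.
  by exists p, q; rewrite up uq.
have vc : continuous (fun t => - u t) by move=> t; apply: cvgN; exact: uc.
have [|||p [q [ap pq qb [/oppr_inj up /oppr_inj uq] H]]] :=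
  @upcrossing (fun t => - u t) a b (- r') (- r) ab vc; [by rewrite ltrN2| | |].
- by rewrite lerN2.
- by rewrite lerN2.
exists p, q; split=> //; first by rewrite up uq setUC.
by move=> t /H; rewrite !ltrN2 andbC.
Qed.

End RealCrossings.

(** * Extending functions from a compact interval to the line *)

Section Clamp.
Context {R : realType}.

(** The retraction of the line onto [[a, b]]: composing with it turns continuity within the interval
    into plain continuity. *)
Definition clamp (a b t : R) := Num.max a (Num.min b t).

Lemma clamp_itv (a b t : R) : a <= b -> `[a, b]%classic (clamp a b t).
Proof. by move=> ab; rewrite /= in_itv/= le_max lexx ge_max ab ge_min lexx. Qed.

Lemma clamp_id (a b t : R) : a <= t <= b -> clamp a b t = t.
Proof. by move=> /andP[at_ tb]; rewrite /clamp min_r// max_r. Qed.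

Lemma continuous_clamp (a b : R) : continuous (clamp a b).
Proof.
move=> t; apply: (@continuous_max _ _ (fun=> a) (fun t => Num.min b t) t).
  exact: cst_continuous.
by apply: (@continuous_min _ _ (fun=> b) id t); [exact: cst_continuous|exact: id].
Qed.

Lemma continuous_comp_clamp (T : topologicalType) (f : R -> T) (a b : R) : a <= b ->
  {within `[a, b], continuous f} -> continuous (f \o clamp a b).
Proof.
move=> ab /subspace_continuousP fc t U /(fc _ (clamp_itv t ab)).
move=> /continuous_clamp; rewrite !nbhs_simpl/=; apply: filterS => s /=.
by apply; exact: clamp_itv.
Qed.

End Clamp.

(** * Comparing cardinalities in the extended reals *)

Section Counting.
Context {R : realType}.
Local Open Scope ereal_scope.

(** Families of [k] distinct elements treat finite and infinite sets alike; later cardinality bounds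
    are proved by transforming such families. *)
Lemma counting_geP (T : choiceType) (A : set T) (k : nat) :
  k%:R%:E <= counting A :> \bar R <->
  exists f : 'I_k -> T, injective f /\ forall i, A (f i).
Proof.
split.
  move=> kA; have [B [BA kB]] : exists B : {fset T}, [set` B] `<=` A /\
      (k <= #|` B|)%N.
    move: kA; rewrite /counting; case: asboolP => [Afin|Ainf _].
      rewrite lee_fin ler_nat => kA; exists (fset_set A); split=> //.
      by move=> x /=; rewrite in_fset_set// => /set_mem.
    by have [B BA kB] := infinite_set_fset k Ainf; exists B.
  have iB (i : 'I_k) : (i < size (enum_fset B))%N by exact: leq_trans (ltn_ord i) kB.
  have x0 (i : 'I_k) : T by case: (enum_fset B) (iB i) => // x.
  (* [nth] takes a default element of [T], which is at hand only if ['I_k] is inhabited. *)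
  case: k => [|k] in kA kB iB x0 *.
    by exists (fun i => x0 i); split=> [[]|[]].
  exists (fun i => nth (x0 ord0) (enum_fset B) i); split=> [i j /eqP|i].
    by rewrite nth_uniq ?fset_uniq// => /eqP /val_inj.
  by apply: BA => /=; apply: mem_nth.
move=> [f [finj fA]]; rewrite /counting; case: asboolP => [Afin|_]; last exact: leey.
rewrite lee_fin ler_nat.
have -> : k = #|` [fset f i | i in 'I_k]%fset|.
  by rewrite card_imfset//= -cardE card_ord.
apply: fsubset_leq_card; apply/fsubsetP => x /imfsetP[i _ ->].
by rewrite in_fset_set//; apply/mem_set/fA.
Qed.

Lemma counting_ge0 (T : choiceType) (A : set T) : 0 <= counting A :> \bar R.
Proof. by rewrite /counting; case: asboolP => // _; rewrite leey. Qed.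

Lemma le_counting_geP (T T' : choiceType) (A : set T) (B : set T') :
  (forall k : nat, k%:R%:E <= counting A :> \bar R -> k%:R%:E <= counting B :> \bar R) ->
  counting A <= counting B :> \bar R.
Proof.
move=> H; have := H; rewrite {1 3}/counting; case: asboolP => [Afin|Ainf]; last first.
  move=> HB; have {}HB k : k%:R%:E <= counting B :> \bar R by apply: HB; rewrite leey.
  rewrite /counting in HB *; case: asboolP HB => // _ /(_ #|` fset_set B|.+1).
  by rewrite lee_fin ler_nat ltnn.
by apply; exact: lexx.
Qed.

Lemma le_counting_inj (T T' : choiceType) (A : set T) (B : set T') (f : T -> T') :
  {in A &, injective f} -> set_fun A B f -> counting A <= counting B :> \bar R.
Proof.
move=> finj fAB; apply: le_counting_geP => k /counting_geP[g [ginj gA]].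
apply/counting_geP; exists (f \o g); split; last by move=> i; exact/fAB/gA.
by move=> i j /= /finj fg; apply/ginj/fg; apply/mem_set/gA.
Qed.

Lemma le_counting (T : choiceType) (A B : set T) :
  A `<=` B -> counting A <= counting B :> \bar R.
Proof. by move=> AB; apply: (@le_counting_inj _ _ _ _ id) => // ? ?. Qed.

Lemma countingU (T : choiceType) (A B : set T) :
  counting (A `|` B) <= counting A + counting B :> \bar R.
Proof.
rewrite /counting; case: (asboolP (finite_set A)) => [Afin|Ainf]; last first.
  by rewrite addye ?leey//; case: asboolP => // _; rewrite ltNyr.
case: (asboolP (finite_set B)) => [Bfin|Binf]; last by rewrite addey ?leey.
rewrite asboolT; last by rewrite finite_setU.
by rewrite fset_setU// -EFinD -natrD lee_fin ler_nat cardfsU leq_subr.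
Qed.

Lemma counting_bigcup_seq (T : choiceType) (I : eqType) (A : set T) (s : seq I)
    (B : I -> set T) : A `<=` [set x | exists2 i, i \in s & B i x] ->
  counting A <= \sum_(i <- s) counting (B i) :> \bar R.
Proof.
elim: s A => [|i s IHs] A AB.
  rewrite big_nil (_ : A = set0); first by rewrite /counting asboolT// fset_set0.
  by apply/seteqP; split=> // x /AB[].
rewrite big_cons.
apply: le_trans (le_counting (_ : A `<=` B i `|` (A `&` ~` B i))) _.
  by move=> x Ax; have [|] := pselect (B i x); [left|right].
apply: le_trans (countingU _ _) _; apply: leeD2l; apply: IHs => x [/AB[j]].
by rewrite inE => /predU1P[->//|js Bjx _]; exists j.
Qed.

End Counting.

(** * Crossings of an annulus as families of nonoverlapping traversals *)

Section Traversals.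
Context {R : realType} {d : nat}.
Implicit Types (g h : @pcurve R d) (x y : 'rV[R]_d) (r : R).

(** Clamped to be continuous on the whole line, as the results on real functions require. *)
Definition radius g x (t : R) : R := edist x (g (clamp (lo g) (hi g) t)).

Lemma radiusE g x t : pcurve_dom g t -> radius g x t = edist x (g t).
Proof. by rewrite /pcurve_dom/= in_itv/= => gt; rewrite /radius clamp_id. Qed.

Lemma continuous_radius g x : continuous (radius g x).
Proof.
move=> t; apply: (@continuous_comp _ _ _ (g \o clamp (lo g) (hi g)) (edist x)).
  by apply: continuous_comp_clamp; [exact/ltW/lo_lt_hi|exact: pcurve_continuous].
exact: continuous_edist.
Qed.

Definition nonoverlapping (I : Type) (a b : I -> R) :=
  forall i j, i <> j -> b i <= a j \/ b j <= a i.

(* A crossing is subject to open conditions inside the interval; these weaker but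
   closed conditions allow as many intervals and pass to limits. *)
Definition traversals g x r r' (k : nat) := exists a b : 'I_k -> R,
  (forall i, [/\ pcurve_dom g (a i), pcurve_dom g (b i), a i <= b i &
     traverses (radius g x) (a i) (b i) r r']) /\ nonoverlapping a b.

Lemma crossing_traverses g x r r' p : r < r' -> pcurve_crossings g x r r' p ->
  traverses (radius g x) p.1 p.2 r r'.
Proof.
move=> rr' [[p1 p2] _ _ pE]; rewrite /traverses !radiusE//.
have r'r : r' <> r by move=> r'r; rewrite r'r ltxx in rr'.
have ha : [set r; r'] (edist x (g p.1)) by rewrite -pE; left.
have hb : [set r; r'] (edist x (g p.2)) by rewrite -pE; right.
have hr : [set edist x (g p.1); edist x (g p.2)] r by rewrite pE; left.
have hr' : [set edist x (g p.1); edist x (g p.2)] r' by rewrite pE; right.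
case: ha hb hr hr' => /= -> [] -> /=; [|by left; rewrite !lexx|by right; rewrite !lexx|].
  by move=> _ [].
by move=> [] /esym.
Qed.

(** At an end point of a crossing the distance to [x] is [r] or [r'], so no end point lies strictly
    inside another crossing; overlapping crossings therefore coincide. *)
Lemma crossings_nonoverlapping g x r r' p q : r < r' ->
  pcurve_crossings g x r r' p -> pcurve_crossings g x r r' q ->
  p <> q -> p.2 <= q.1 \/ q.2 <= p.1.
Proof.
move=> rr' [[p1 p2] p12 pin pE] [[q1 q2] q12 qin qE] pq.
have notin z s : pcurve_crossings g x r r' z -> s = z.1 \/ s = z.2 ->
    r < edist x (g s) < r' -> False.
  move=> [_ _ _ zE] sz sin.
  have : [set r; r'] (edist x (g s)) by rewrite -zE; case: sz => ->; [left|right].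
  by case=> sE; move: sin; rewrite sE ltxx ?andbF.
have [|pq1] := leP p.2 q.1; first by left.
have [|qp1] := leP q.2 p.1; first by right.
exfalso; apply: pq; rewrite [p]surjective_pairing [q]surjective_pairing.
congr pair.
  have [pq'|qp'|//] := ltgtP p.1 q.1.
    by exfalso; apply: (@notin q q.1) => //; [left|apply: pin; rewrite pq'].
  by exfalso; apply: (@notin p p.1) => //; [left|apply: qin; rewrite qp'].
have [pq'|qp'|//] := ltgtP p.2 q.2.
  by exfalso; apply: (@notin p p.2) => //; [right|apply: qin; rewrite pq1].
by exfalso; apply: (@notin q q.2) => //; [right|apply: pin; rewrite qp1].
Qed.

(** Every traversal contains a crossing, and every crossing is a traversal. *)
Lemma traversals_ncross g x r r' k : r < r' ->
  traversals g x r r' k <-> (k%:R%:E <= pcurve_ncross g x r r')%E.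
Proof.
move=> rr'; split.
  move=> [a [b [ab abn]]].
  have /choice[f fP] : forall i, exists p : R * R,
      [/\ pcurve_crossings g x r r' p, a i <= p.1 & p.2 <= b i].
    move=> i; have [ai bi aibi abi] := ab i.
    have [p [q [ap pq qb E H]]] := crossing aibi (@continuous_radius g x) rr' abi.
    have dom t : p <= t <= q -> pcurve_dom g t.
      move=> /andP[pt tq]; move: ai bi; rewrite /pcurve_dom/= !in_itv/=.
      move=> /andP[la _] /andP[_ bh].
      by rewrite (le_trans la)//= ?(le_trans ap)// (le_trans tq)// (le_trans qb).
    exists (p, q); split=> //=; split=> //=.
    - by split; apply: dom; rewrite lexx ltW.
    - move=> t /andP[pt tq]; rewrite -radiusE; first by apply: H; rewrite pt.
      by apply: dom; rewrite !ltW.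
    - by rewrite -!radiusE//; apply: dom; rewrite lexx ltW.
  apply/counting_geP; exists f; split=> [i j fij|i]; last by case: (fP i).
  (* A crossing common to two nonoverlapping intervals would have length at most 0. *)
  apply/eqP; apply: contrapT => /negP/eqP/abn.
  have [[_ fi _ _] ai bi] := fP i; have [_ aj bj] := fP j.
  case=> ba; move: fi; apply/negP; rewrite -leNgt.
    by rewrite (le_trans bi)// (le_trans ba)// fij.
  by rewrite [in leLHS]fij (le_trans bj)// (le_trans ba).
move=> /counting_geP[f [finj fA]].
exists (fun i => (f i).1), (fun i => (f i).2); split.
  move=> i; have [[f1 f2] f12 _ _] := fA i; split=> //; first exact: ltW.
  exact: crossing_traverses.
by move=> i j ij; apply: crossings_nonoverlapping (fA i) (fA j) _ => // /finj.
Qed.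

End Traversals.

(** * Limits along ultrafilters *)

Section Ultrafilter.

Lemma ultra_fmap (T U : Type) (f : T -> U) (F : set_system T) :
  UltraFilter F -> UltraFilter (f @ F).
Proof.
move=> FU; split=> [|G GF FG]; first exact: fmap_proper_filter.
apply/seteqP; split=> // A GA.
have [//|FnA] := in_ultra_setVsetC (f @^-1` A) FU.
have : G (A `&` ~` A) by apply: filterI => //; apply: FG.
by rewrite setICr => /filter_not_empty.
Qed.

(** Plays the role of passing to a subsequence on which the same alternative always holds. *)
Lemma ultra_orP (T : Type) (F : set_system T) (P Q : T -> Prop) :
  UltraFilter F -> (forall x, P x \/ Q x) ->
  (\forall x \near F, P x) \/ (\forall x \near F, Q x).
Proof.
move=> FU PQ; have [|FnP] := in_ultra_setVsetC P FU; [by left|right].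
by apply: filterS FnP => x; case: (PQ x).
Qed.

End Ultrafilter.

(** * Crossings of a single curve: semicontinuity and localization to balls *)

Section Semicontinuity.
Context {R : realType} {d : nat}.
Implicit Types (g h : @pcurve R d) (x y : 'rV[R]_d) (r : R).

(** By compactness of the domain, the end points obtained for [e = n.+1%:R^-1] converge along an
    ultrafilter, which also fixes the direction of each traversal and the order of each pair. The
    conditions are closed, so they hold in the limit. *)
Lemma traversals_cvg g x r r' k :
  (forall e, 0 < e -> traversals g x (r + e) (r' - e) k) ->
  traversals g x r r' k.
Proof.
move=> H.
have /choice[a /choice[b ab]] : forall n : nat, exists a b : 'I_k -> R,
    (forall i, [/\ pcurve_dom g (a i), pcurve_dom g (b i), a i <= b i &
      traverses (radius g x) (a i) (b i) (r + n.+1%:R^-1) (r' - n.+1%:R^-1)]) /\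
    nonoverlapping a b.
  by move=> n; apply: H; rewrite invr_gt0.
have [U [UU UN]] := ultraFilterLemma eventually_filter.
have dom_cvg (c : nat -> R) : (forall n, pcurve_dom g (c n)) ->
    exists2 l, pcurve_dom g l & c @ U --> l.
  move=> gc; have cU := ultra_fmap c UU.
  have := @segment_compact R (lo g) (hi g); rewrite compact_ultra.
  by move=> /(_ _ cU) [|l [? ?]]; [exact: nearW|exists l].
have /choice[A AP] : forall i, exists l, pcurve_dom g l /\ a n i @[n --> U] --> l.
  move=> i; have [n|l gl al] := dom_cvg (a ^~ i); last by exists l.
  by have [/(_ i)[]] := ab n.
have /choice[B BP] : forall i, exists l, pcurve_dom g l /\ b n i @[n --> U] --> l.
  move=> i; have [n|l gl al] := dom_cvg (b ^~ i); last by exists l.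
  by have [/(_ i)[]] := ab n.
have cvg_inv : n.+1%:R^-1 @[n --> U] --> (0 : R).
  by apply: cvg_trans cvg_harmonic; exact: cvg_app.
have cvg_r : r + n.+1%:R^-1 @[n --> U] --> r.
  by rewrite -[X in _ --> X]addr0; apply: cvgD => //; exact: cvg_cst.
have cvg_r' : r' - n.+1%:R^-1 @[n --> U] --> r'.
  by rewrite -[X in _ --> X]subr0; apply: cvgB => //; exact: cvg_cst.
have radA i : radius g x (a n i) @[n --> U] --> radius g x (A i).
  by apply: cvg_comp (AP i).2 _; exact: continuous_radius.
have radB i : radius g x (b n i) @[n --> U] --> radius g x (B i).
  by apply: cvg_comp (BP i).2 _; exact: continuous_radius.
exists A, B; split=> [i|i j ij].
  split; [exact: (AP i).1|exact: (BP i).1| |].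
    apply: ler_cvg_to (AP i).2 (BP i).2 _; apply: nearW => n.
    by have [/(_ i)[]] := ab n.
  have [|near_up|near_down] := ultra_orP UU
      (P := fun n => radius g x (a n i) <= r + n.+1%:R^-1 /\
                     r' - n.+1%:R^-1 <= radius g x (b n i))
      (Q := fun n => r' - n.+1%:R^-1 <= radius g x (a n i) /\
                     radius g x (b n i) <= r + n.+1%:R^-1).
  - by move=> n; have [/(_ i)[_ _ _]] := ab n.
  - left; split.
      by apply: ler_cvg_to (radA i) cvg_r _; apply: filterS near_up => n [].
    by apply: ler_cvg_to cvg_r' (radB i) _; apply: filterS near_up => n [].
  - right; split.
      by apply: ler_cvg_to cvg_r' (radA i) _; apply: filterS near_down => n [].
    by apply: ler_cvg_to (radB i) cvg_r _; apply: filterS near_down => n [].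
have [||] := ultra_orP UU (P := fun n => b n i <= a n j) (Q := fun n => b n j <= a n i).
- by move=> n; have [_] := ab n; apply.
- by left; apply: ler_cvg_to (BP i).2 (AP j).2 _.
- by right; apply: ler_cvg_to (BP j).2 (AP i).2 _.
Qed.

Lemma incr_homeo_inverse (I J : set R) s : incr_homeo I J s ->
  exists t, [/\ set_fun J I t, forall a, J a -> s (t a) = a &
    forall a b, J a -> J b -> a <= b -> t a <= t b].
Proof.
move=> [sm [t [[_ tJ] [_ st] _ _]]]; exists t; split=> //.
  by move=> y Jy; apply/st/mem_set.
move=> y z Jy Jz yz; rewrite leNgt; apply/negP => tzy.
have := sm _ _ (mem_set (tJ _ Jz)) (mem_set (tJ _ Jy)) tzy.
by rewrite !st ?ltNge ?yz//; exact: mem_set.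
Qed.

(** A reparametrization that nearly realizes the distance carries the intervals from [h] to [g],
    keeps their order and changes the radii by at most [e]. *)
Lemma traversals_dist g h x r r' e k : (pcurve_dist g h < e%:E)%E ->
  traversals h x r r' k -> traversals g x (r + e) (r' - e) k.
Proof.
move=> /ereal_inf_lt[_ [s sgh <-]] /ltW se [a [b [ab abn]]].
have [t [tf st tmono]] := incr_homeo_inverse sgh.
have radt u : pcurve_dom h u -> `|radius g x (t u) - radius h x u| <= e.
  move=> hu; rewrite !radiusE//; last exact: tf.
  have gh : edist (g (t u)) (h u) <= e.
    rewrite -lee_fin (le_trans _ se)//; apply: ereal_sup_ubound.
    by exists (t u); [exact: tf|rewrite st].
  have := edist_triangle x (g (t u)) (h u); have := edist_triangle x (h u) (g (t u)).
  by rewrite ler_norml (edistC (h u)); lra.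
exists (t \o a), (t \o b); split.
  move=> i; have [ai bi aibi abi] := ab i; split=> /=.
  - exact: tf.
  - exact: tf.
  - exact: tmono.
  have := radt _ ai; have := radt _ bi; rewrite !ler_norml.
  by case: abi => -[? ?] /andP[? ?] /andP[? ?]; [left|right]; split; lra.
move=> i j ij; have [ai bi _ _] := ab i; have [aj bj _ _] := ab j.
by case: (abn i j ij) => ba; [left|right]; exact: tmono.
Qed.

(** If [g] has exactly [m] crossings, then for some [e] it lacks [m.+1] traversals between [r + e]
    and [r' - e]. A curve within [e] of [g] with more than [m] crossings would provide them. *)
Lemma pcurve_ncross_usc g x r r' : r < r' -> (pcurve_ncross g x r r' < +oo)%E ->
  exists2 e, 0 < e & forall h, (pcurve_dist g h < e%:E)%E ->
    (pcurve_ncross h x r r' <= pcurve_ncross g x r r')%E.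
Proof.
move=> rr' gfin.
have [m gm] : exists m : nat, pcurve_ncross g x r r' = m%:R%:E.
  by move: gfin; rewrite /pcurve_ncross /counting; case: asboolP => // _ _; eexists.
have : ~ traversals g x r r' m.+1.
  by rewrite traversals_ncross// gm lee_fin ler_nat ltnn.
move=> /(contra_not (@traversals_cvg _ _ _ _ _)) /existsNP[e].
move=> /not_implyP[e0 gN]; exists e => // h gh; apply: le_counting_geP => k hk.
rewrite -[counting _]/(pcurve_ncross g x r r') gm lee_fin ler_nat leqNgt.
apply/negP => mk; apply: gN; apply: traversals_dist gh _.
rewrite traversals_ncross//; apply: le_trans hk.
by rewrite lee_fin ler_nat.
Qed.

Lemma traversals_diam g x r r' k : traversals g x r r' k.+1 ->
  ((r' - r)%:E <= pcurve_diam g)%E.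
Proof.
move=> [a [b [/(_ ord0)[ai bi _ abi] _]]].
apply: (@le_trans _ _ (edist (g (a ord0)) (g (b ord0)))%:E).
  rewrite lee_fin; move: abi; rewrite /traverses !radiusE//.
  have := edist_triangle x (g (a ord0)) (g (b ord0)).
  have := edist_triangle x (g (b ord0)) (g (a ord0)).
  by rewrite (edistC (g (b ord0))) => ? ? [] [] *; lra.
by apply: ereal_sup_ubound; exists (a ord0, b ord0).
Qed.

Definition ball_crossings g x r r' (q : 'rV[R]_d * R) : set (R * R) :=
  pcurve_crossings g x r r' `&`
  [set p | exists t, p.1 <= t <= p.2 /\ edist q.1 (g t) <= q.2].

(** Cut each crossing at a time in the ball and keep a piece that ends at distance at least [s] from
    the centre. These pieces traverse the annulus around [q.1] and inherit nonoverlapping from the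
    crossings. *)
Lemma ball_crossings_le g x r r' q s : r < r' -> q.2 < s ->
  s <= (r' - r) / 2 ->
  (counting (ball_crossings g x r r' q) <= pcurve_ncross g q.1 q.2 s)%E.
Proof.
move=> rr' qs sq; apply: le_counting_geP => k /counting_geP[f [finj fA]].
apply/traversals_ncross => //.
have /choice[c cP] : forall i, exists c : R * R, [/\ (f i).1 <= c.1,
    c.1 <= c.2, c.2 <= (f i).2 &
    traverses (radius g q.1) c.1 c.2 q.2 s].
  move=> i; have [fi [t [/andP[ft tf] qt]]] := fA i.
  have := crossing_traverses rr' fi; have [[f1 f2] f12 _ _] := fi.
  have gt : pcurve_dom g t.
    move: f1 f2; rewrite /pcurve_dom/= !in_itv/= => /andP[+ _] /andP[_ +].
    by move=> /le_trans -> //= /(le_trans tf) ->.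
  rewrite /traverses !radiusE// => fE.
  (* The end points are at least [r' - r >= 2 * s] apart, so they cannot both be closer than [s] to
     [q.1]. *)
  have far : s <= edist q.1 (g (f i).1) \/ s <= edist q.1 (g (f i).2).
    have := edist_triangle x (g (f i).1) (g (f i).2).
    have := edist_triangle x (g (f i).2) (g (f i).1).
    have := edist_triangle (g (f i).1) q.1 (g (f i).2).
    rewrite (edistC (g (f i).1) q.1) (edistC (g (f i).2) (g (f i).1)) => ? ? ?.
    have [|s1] := leP s (edist q.1 (g (f i).1)); first by left.
    have [|s2] := leP s (edist q.1 (g (f i).2)); first by right.
    by case: fE => -[? ?]; lra.
  by case: far => far; [exists ((f i).1, t)|exists (t, (f i).2)]; split=> //=;
    rewrite !radiusE//; [right|left].
exists (fst \o c), (snd \o c); split.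
  move=> i; have [fc cc cf tr] := cP i.
  have [[[f1 f2] _ _ _] _] := fA i; split=> //=.
  - move: f1 f2; rewrite /pcurve_dom/= !in_itv/= => /andP[+ _] /andP[_ +].
    by move=> /le_trans -> //= /(le_trans cf)/(le_trans cc) ->.
  - move: f1 f2; rewrite /pcurve_dom/= !in_itv/= => /andP[+ _] /andP[_ +].
    by move=> /le_trans -> /=; [move=> /(le_trans cf)|exact: le_trans cc].
move=> i j ij /=; have [fi ci] := fA i; have [fj cj] := fA j.
have [fci cci cfi _] := cP i; have [fcj ccj cfj _] := cP j.
have := crossings_nonoverlapping rr' fi fj (fun E => ij (finj _ _ E)).
by case=> ff; [left|right]; [rewrite (le_trans cfi)// (le_trans ff)|
  rewrite (le_trans cfj)// (le_trans ff)].
Qed.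

Lemma pcurve_ncross_cover g x r r' s (l : seq ('rV[R]_d * R)) : r < r' ->
  s <= (r' - r) / 2 -> (forall q, q \in l -> q.2 < s) ->
  (forall p, pcurve_crossings g x r r' p -> exists2 q, q \in l &
     exists t, p.1 <= t <= p.2 /\ edist q.1 (g t) <= q.2) ->
  (pcurve_ncross g x r r' <= \sum_(q <- l) pcurve_ncross g q.1 q.2 s)%E.
Proof.
move=> rr' sr ls lcover.
apply: (@le_trans _ _ (\sum_(q <- l) counting (ball_crossings g x r r' q))%E).
  apply: counting_bigcup_seq => p gp; have [q ql qp] := lcover _ gp.
  by exists q.
rewrite big_seq [leRHS]big_seq; apply: lee_sum => q /ls qs.
exact: ball_crossings_le.
Qed.

End Semicontinuity.

(** * Comparison of sums over arbitrary index sets *)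

Section Esum.
Context {R : realType}.
Local Open Scope ereal_scope.

Lemma le_esum_subset (T : choiceType) (A B : set T) (a : T -> \bar R) :
  A `<=` B -> \esum_(i in A) a i <= \esum_(i in B) a i.
Proof.
move=> AB; apply: le_ereal_sup => _ [X [Xfin XA] <-].
by exists X => //; split=> //; exact: subset_trans AB.
Qed.

Lemma le_esum_inj (T T' : choiceType) (A : set T) (B : set T') (f : T -> T')
    (a : T -> \bar R) (b : T' -> \bar R) :
  set_fun A B f -> {in A &, injective f} ->
  (forall i, A i -> a i <= b (f i)) ->
  \esum_(i in A) a i <= \esum_(i in B) b i.
Proof.
move=> fAB finj ab; apply: (@le_trans _ _ (\esum_(i in f @` A) b i)).
  by rewrite esum_image//; exact: le_esum.
by apply: le_esum_subset => _ [i Ai <-]; exact: fAB.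
Qed.

Lemma sup0_ge (A : set (\bar R)) x : A x -> x <= sup0 A.
Proof. by move=> Ax; apply: ereal_sup_ubound; right. Qed.

End Esum.

(** * Semicontinuity of the crossing number of a path collection *)

Section Collections.
Context {R : realType} {d : nat}.
Implicit Types (G : path_coll R d) (c : curve R d) (x : 'rV[R]_d).

Lemma curve_ncross_ge0 c x r r' : (0 <= curve_ncross c x r r')%E.
Proof. exact: counting_ge0. Qed.

(** Summing over copies instead of weighting by multiplicity lets a matching act as an injection
    between index sets. *)
Lemma ncrossE G x r r' :
  (ncross G x r r' = \esum_(q in elements G) curve_ncross q.1 x r r')%E.
Proof.
pose J c := `I_(G c).
have -> : elements G = [set: curve R d] `*`` J.
  by apply/seteqP; split=> q //= [].
rewrite -(esum_esum (a := fun c _ => curve_ncross c x r r')); last first.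
  by move=> *; exact: curve_ncross_ge0.
apply: eq_esum => c _; rewrite esum_fset; [|exact: finite_II|].
  by rewrite -(fsbig_ord _ _ (fun=> curve_ncross c x r r')) sumr_const card_ord mule_natl.
by move=> *; exact: curve_ncross_ge0.
Qed.

Lemma curve_ncross_le G c x r r' : (0 < G c)%N ->
  (curve_ncross c x r r' <= ncross G x r r')%E.
Proof.
move=> Gc; rewrite ncrossE.
rewrite -(esum_set1 (t := (c, 0%N)) (a := fun q => curve_ncross q.1 x r r')).
  by apply: le_esum_subset => _ ->.
exact: curve_ncross_ge0.
Qed.

Lemma curve_ncross_gt0 c x r r' : r < r' -> (0 < curve_ncross c x r r')%E ->
  traversals (repr c) x r r' 1.
Proof.
move=> rr' c0; apply/traversals_ncross => //; move: c0.
rewrite /curve_ncross /pcurve_ncross /counting; case: asboolP => _; last by rewrite leey.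
by rewrite !lte_fin !lee_fin ltr0n ler1n.
Qed.

(* A curve of G' with a crossing is matched, in any matching of small cost, to
   one of the finitely many curves of G of diameter larger than (r' - r) / 2. *)
Lemma ncross_usc G x r r' : r < r' -> (ncross G x r r' < +oo)%E ->
  exists2 e, 0 < e & forall G', (path_coll_dist G G' < e%:E)%E ->
    (ncross G' x r r' <= ncross G x r r')%E.
Proof.
move=> rr' Gfin.
pose D := (r' - r) / 2; have D0 : 0 < D by rewrite /D; lra.
have Sfin := mult_finite G D0.
(* Finitely many curves allow a common [e]. Since [e <= D / 4], a curve of [G'] with a crossing has
   diameter at least [2 * D > e] and must be matched; its partner has diameter at least
   [2 * D - 2 * e > D]. *)
have [e [e0 eD eS]] : exists e : R, [/\ 0 < e, e <= D / 4 &
    forall c, msupport_gt G D c -> forall h, (pcurve_dist (repr c) h < e%:E)%E ->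
      (pcurve_ncross h x r r' <= curve_ncross c x r r')%E].
  pose P (e : R) c := forall h, (pcurve_dist (repr c) h < e%:E)%E ->
    (pcurve_ncross h x r r' <= curve_ncross c x r r')%E.
  have Pnear c : c \in fset_set (msupport_gt G D) -> \forall e \near 0^'+, P e c.
    rewrite in_fset_set// => /set_mem[Gc _].
    have [|e e0 He] := @pcurve_ncross_usc _ _ (repr c) x r r' rr'.
      exact: le_lt_trans (curve_ncross_le _ _ _ Gc) Gfin.
    near=> e'; move=> h he'; apply: He; apply: lt_le_trans he' _.
    by rewrite lee_fin; near: e'; exact: nbhs_right_le.
  have near_all := filter_bigI _ Pnear.
  near (0 : R)^'+ => e; exists e; split.
  - by near: e; exact: nbhs_right_gt.
  - by near: e; apply: nbhs_right_le; lra.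
  - move=> c Sc; have : (\bigcap_(c in [set` fset_set (msupport_gt G D)]) P^~ c) e.
      by near: e; exact: near_all.
    by apply; rewrite /= in_fset_set//; exact: mem_set.
exists e => // G' /ereal_inf_lt[_ [pi [pisub piinj1 piinj2] <-]].
rewrite /matching_cost !gt_max => /and3P[pi_dist _ pi_un'].
rewrite !ncrossE.
(* Elements of [G'] without crossings contribute 0; they are set aside because they may be
   unmatched. *)
rewrite (esumID [set q | (0 < curve_ncross q.1 x r r')%E]); last first.
  by move=> *; exact: curve_ncross_ge0.
rewrite [X in (_ + X)%E]esum1 ?adde0; last first.
  move=> q [_ /negP]; rewrite -leNgt => q0; apply/eqP.
  by rewrite eq_le q0 curve_ncross_ge0.
have /choice[f fP] : forall q', exists q : curve R d * nat,
    elements G' q' -> (0 < curve_ncross q'.1 x r r')%E -> pi (q, q').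
  move=> q'; have [[q qq']|npi] := pselect (exists q, pi (q, q')).
    by exists q.
  exists q' => G'q' q'0; exfalso.
  have : (curve_diam q'.1 < e%:E)%E.
    apply: le_lt_trans pi_un'; apply: sup0_ge; exists q' => //; split=> //.
    by move=> [[q q''] qq' /= q''E]; apply: npi; exists q; rewrite -q''E.
  apply/negP; rewrite -leNgt.
  apply: le_trans (traversals_diam (curve_ncross_gt0 rr' q'0)).
  by rewrite lee_fin (le_trans eD)// /D; lra.
have fdist q' : elements G' q' -> (0 < curve_ncross q'.1 x r r')%E ->
    (curve_dist (f q').1 q'.1 < e%:E)%E.
  move=> G'q' q'0; apply: le_lt_trans pi_dist; apply: sup0_ge.
  by exists (f q', q') => //; exact: fP.
apply: (@le_esum_inj _ _ _ _ _ f).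
- by move=> q' [G'q' q'0]; have [] := pisub _ (fP _ G'q' q'0).
- move=> q1 q2 /set_mem[G1 q10] /set_mem[G2 q20] fE.
  suff [] : (f q1, q1) = (f q2, q2) by [].
  by apply: piinj1 => //; apply/mem_set; exact: fP.
move=> q' [G'q' q'0]; apply: eS; last exact: fdist.
have [Gf _] := pisub _ (fP _ G'q' q'0).
split; first exact: leq_ltn_trans Gf.
have := traversals_dist (fdist _ G'q' q'0) (curve_ncross_gt0 rr' q'0).
move=> /traversals_diam; apply: lt_le_trans.
by rewrite lte_fin /D; move: e0 eD; rewrite /D; lra.
Unshelve. all: by end_near. Qed.

End Collections.

(** * Covering cubes in coordinate hyperplanes by balls finer than a gauge *)

Section GaugeCover.
Context {R : realType} {d : nat}.
Implicit Types (y z : 'rV[R]_d) (j k : 'I_d) (l v : R) (A : set 'rV[R]_d).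
Implicit Type gauge : 'rV[R]_d -> R.

Definition gauge_cover gauge A v := exists s : seq ('rV[R]_d * R),
  [/\ forall q, q \in s -> 0 < q.2 < gauge q.1,
      forall y, A y -> exists2 q, q \in s & edist q.1 y <= q.2 &
      \sum_(q <- s) q.2 ^+ d.-1 <= v].

Lemma gauge_cover_bigcup gauge (I : eqType) (r : seq I) A (B : I -> set 'rV[R]_d) v :
  A `<=` [set y | exists2 i, i \in r & B i y] ->
  (forall i, i \in r -> gauge_cover gauge (B i) v) ->
  gauge_cover gauge A ((size r)%:R * v).
Proof.
elim: r A => [|i r IHr] A AB Bv.
  by exists [::]; split=> // [y /AB[]//|]; rewrite big_nil mul0r.
have [s [sg sB sv]] := Bv i (mem_head _ _).
have [||t [tg tA tv]] := IHr [set y | exists2 i, i \in r & B i y].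
- by [].
- by move=> k kr; apply: Bv; rewrite inE kr orbT.
exists (s ++ t); split.
- by move=> q; rewrite mem_cat => /orP[/sg|/tg].
- move=> y /AB[k]; rewrite inE => /predU1P[->|kr] By.
    by have [q qs qy] := sB _ By; exists q => //; rewrite mem_cat qs.
  have [|q qt qy] := tA y; first by exists k.
  by exists q => //; rewrite mem_cat qt orbT.
- by rewrite big_cat/= -(addn1 (size r)) natrD mulrDl mul1r addrC lerD.
Qed.

(** A cube of dimension [d.-1] and side [l] with lowest corner [z]; the factor [(k != j)] freezes
    coordinate [j]. *)
Definition face j z l : set 'rV[R]_d :=
  [set y | forall k, z 0 k <= y 0 k <= z 0 k + (k != j)%:R * l].

(** [S] is the set of coordinates in which the upper half is taken; for a face orthogonal to
    direction [j] it ranges over the subsets avoiding [j]. *)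
Definition subcorner z l (S : {set 'I_d}) : 'rV[R]_d :=
  \row_k (z 0 k + (k \in S)%:R * (l / 2)).

Lemma face_subdivision j z l :
  face j z l `<=` [set y | exists2 S, S \in enum (powerset [set~ j]%SET) &
                           face j (subcorner z l S) (l / 2) y].
Proof.
move=> y yF; exists [set k | (k != j) && (z 0 k + l / 2 < y 0 k)]%SET.
  rewrite mem_enum inE; apply/fintype.subsetP => k.
  by rewrite !inE => /andP[].
move=> k; rewrite mxE inE; have := yF k.
by have [->|kj] := eqVneq k j; case: ltP => /=; lra.
Qed.

Lemma face_subcorner j z l (S : {set 'I_d}) : 0 <= l -> S \subset [set~ j]%SET ->
  face j (subcorner z l S) (l / 2) `<=` face j z l.
Proof.
move=> l0 Sj y yF k; have := yF k; rewrite mxE.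
have [->|kj] := eqVneq k j; last by case: (k \in S); rewrite /=; lra.
by have [/(fintype.subsetP Sj)|] := boolP (j \in S); [rewrite !inE eqxx|rewrite /=; lra].
Qed.

(* Cousin's lemma for a face, with control on the total content of the balls:
   otherwise bisection gives nested faces without such a cover, and one ball
   around their common point covers the small ones. *)
Lemma gauge_cover_face gauge j z l : (forall y, 0 < gauge y) -> 0 < l ->
  gauge_cover gauge (face j z l) ((d%:R * l) ^+ d.-1).
Proof.
move=> gauge0 l0; apply: contrapT => bad0.
pose bad z l := ~ gauge_cover gauge (face j z l) ((d%:R * l) ^+ d.-1).
have step z1 l1 : exists z2, 0 < l1 -> bad z1 l1 ->
    bad z2 (l1 / 2) /\ face j z2 (l1 / 2) `<=` face j z1 l1.
  have [[S Sj Sbad]|nobad] := pselect (exists2 S, S \in enum (powerset [set~ j]%SET) &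
      bad (subcorner z1 l1 S) (l1 / 2)).
    exists (subcorner z1 l1 S) => l10 _; split=> //; apply: face_subcorner.
      exact: ltW.
    by move: Sj; rewrite mem_enum inE.
  exists z1 => l10 bad1; exfalso; apply: bad1.
  (* Subdivision preserves the bound exactly: there are [2 ^ d.-1] pieces, and halving the side
     divides the bound by [2 ^ d.-1]. *)
  have -> : (d%:R * l1) ^+ d.-1 = (size (enum (powerset [set~ j]%SET)))%:R *
      (d%:R * (l1 / 2)) ^+ d.-1.
    rewrite -cardE card_powerset cardsC1 card_ord natrX -exprMn.
    by congr (_ ^+ _); field.
  apply: (gauge_cover_bigcup (@face_subdivision j z1 l1)) => S Sj.
  by apply: contrapT => Sbad; apply: nobad; exists S.
have {step}[next nextP] : exists next : 'rV[R]_d -> R -> 'rV[R]_d,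
    forall z l, 0 < l -> bad z l ->
    bad (next z l) (l / 2) /\ face j (next z l) (l / 2) `<=` face j z l.
  have /choice[next nextP] : forall zl : 'rV[R]_d * R, exists z2, 0 < zl.2 ->
      bad zl.1 zl.2 -> bad z2 (zl.2 / 2) /\ face j z2 (zl.2 / 2) `<=` face j zl.1 zl.2.
    by move=> [z1 l1]; exact: step.
  by exists (fun z l => next (z, l)) => z1 l1; exact: nextP (z1, l1).
pose L n : R := l / 2 ^+ n.
have L0 n : 0 < L n by rewrite divr_gt0 ?exprn_gt0.
have LS n : L n.+1 = L n / 2 by rewrite /L exprS; field; rewrite expf_neq0.
pose Z := fix Z n := if n is m.+1 then next (Z m) (L m) else z.
have Zbad n : bad (Z n) (L n).
  elim: n => [|n IHn]; first by rewrite /bad /L expr0 divr1.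
  by rewrite LS; have [] := nextP _ _ (L0 n) IHn.
have Zsub m n : face j (Z (n + m)%N) (L (n + m)%N) `<=` face j (Z m) (L m).
  elim: n => // n IHn; apply: subset_trans IHn; rewrite addSn LS.
  by have [] := nextP _ _ (L0 (n + m)%N) (Zbad (n + m)%N).
have cornerP n z1 : face j (Z n) (L n) (Z n).
  by move=> k; rewrite lexx lerDl mulr_ge0// ltW.
have Zle m n k : Z n 0 k <= Z m 0 k + (k != j)%:R * L m.
  have /(_ k)/andP[_ h] := Zsub m n _ (cornerP _ z).
  have /(_ k)/andP[h' _] := Zsub n m _ (cornerP _ z).
  by rewrite addnC in h'; exact: le_trans h' h.
(* The faces are nested, so their lowest corners increase in each coordinate and the supremum lies
   in all of them. *)
pose y : 'rV[R]_d := \row_k sup [set Z n 0 k | n in setT].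
have yF n : face j (Z n) (L n) y.
  move=> k; rewrite mxE; apply/andP; split.
    apply: ub_le_sup; last by exists n.
    by exists (Z n 0 k + (k != j)%:R * L n) => _ [m _ <-].
  apply: ge_sup; first by exists (Z 0 0 k), 0%N.
  by move=> _ [m _ <-].
have d0 : (0 : R) < d%:R by rewrite ltr0n (leq_ltn_trans _ (ltn_ord j)).
have [n nP] : exists n, d%:R * L n < gauge y.
  pose N := Num.bound (d%:R * l / gauge y).
  have lN : d%:R * l / gauge y < N%:R.
    by apply: archi_boundP; rewrite divr_ge0// ?mulr_ge0// ltW.
  exists N; rewrite /L mulrA ltr_pdivrMr ?exprn_gt0// -ltr_pdivrMl//.
  rewrite mulrC (lt_trans lN)//.
  by have := ltn_expl N (isT : (1 < 2)%N); rewrite -(ltr_nat R) natrX.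
(* Points of the face differ from [y] by at most [L n] in each coordinate, so this ball contains it;
   its content equals the allowed bound. *)
apply: (Zbad n); exists [:: (y, d%:R * L n)]; split.
- by move=> q; rewrite inE => /eqP ->/=; rewrite nP mulr_gt0.
- move=> w wF; exists (y, d%:R * L n); first exact: mem_head.
  apply: edist_le_coord => [|k]; first exact: ltW.
  have := yF n k; have := wF k; rewrite ler_norml.
  have := L0 n; case: (k != j) => /=; lra.
- by rewrite big_seq1.
Qed.

End GaugeCover.

(** * Every crossing meets one of finitely many faces *)

Section CrossingCover.
Context {R : realType} {d : nat}.
Implicit Types (g : @pcurve R d) (x : 'rV[R]_d) (j k : 'I_d) (r : R).

(** Lowest corner of the [m]-th slice, orthogonal to direction [j] and with spacing [h], of the cube
    of side [2 * r'] centred at [x]. *)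
Definition grid_corner x r' (h : R) j (m : nat) : 'rV[R]_d :=
  \row_k (x 0 k - r' + (k == j)%:R * (m%:R * h)).

Lemma crossing_far g x r r' p : r < r' -> pcurve_crossings g x r r' p ->
  exists j, (r' - r) / (2 * d%:R) < `|g p.1 0 j - g p.2 0 j|.
Proof.
move=> rr' gp; have [[p1 p2] _ _ _] := gp; apply: contrapT => /forallNP near.
have := crossing_traverses rr' gp; rewrite /traverses !radiusE//.
have : edist (g p.1) (g p.2) <= (r' - r) / 2.
  have [d0|d0] := eqVneq (d%:R : R) 0.
    have /eqP -> : edist (g p.1) (g p.2) == 0.
      rewrite eq_le edist_ge0 andbT (le_trans (edist_le_coord (lexx 0) _)) ?mulr0//.
      move=> i; have : (0 < d)%N by exact: leq_ltn_trans (ltn_ord i).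
      by rewrite lt0n -(pnatr_eq0 R) d0 eqxx.
    by rewrite divr_ge0// subr_ge0 ltW.
  rewrite (_ : _ / 2 = d%:R * ((r' - r) / (2 * d%:R))); last by field.
  apply: edist_le_coord => [|i].
    by rewrite divr_ge0// subr_ge0 ltW.
  by rewrite leNgt; apply/negP; exact: near.
have := edist_triangle x (g p.1) (g p.2).
have := edist_triangle x (g p.2) (g p.1).
by rewrite (edistC (g p.2)) => ? ? ? [] [] *; lra.
Qed.

Lemma continuous_coord g j : continuous (fun t => g (clamp (lo g) (hi g) t) 0 j).
Proof.
move=> t; apply: (@continuous_comp _ _ _ (g \o clamp (lo g) (hi g))
  (fun y : 'rV[R]_d => y 0 j)).
  by apply: continuous_comp_clamp; [exact/ltW/lo_lt_hi|exact: pcurve_continuous].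
exact: coord_continuous.
Qed.

(** Some coordinate differs by more than [h] between the end points, so a grid level lies between
    its two values and is attained. The other coordinates stay in the cube because a crossing stays
    within [r'] of [x]. *)
Lemma crossing_face g x r r' p : 0 < r -> r < r' -> pcurve_crossings g x r r' p ->
  let h := (r' - r) / (2 * d%:R) in
  exists j m t, [/\ m%:R * h <= 2 * r', p.1 <= t <= p.2 &
     face j (grid_corner x r' h j m) (2 * r') (g t)].
Proof.
move=> r0 rr' gp h; have [j far] := crossing_far rr' gp.
have [[p1 p2] p12 pin pE] := gp.
have d0 : (0 : R) < d%:R by rewrite ltr0n (leq_ltn_trans _ (ltn_ord j)).
have h0 : 0 < h by rewrite /h divr_gt0 ?subr_gt0// mulr_gt0.
have dom t : p.1 <= t <= p.2 -> pcurve_dom g t.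
  move: p1 p2; rewrite /pcurve_dom/= !in_itv/= => /andP[+ _] /andP[_ +] /andP[pt tp].
  by move=> /le_trans -> //= /(le_trans tp).
have inball t : p.1 <= t <= p.2 -> edist x (g t) <= r'.
  have endp s : s = p.1 \/ s = p.2 -> edist x (g s) <= r'.
    move=> sp; have : [set r; r'] (edist x (g s)).
      by rewrite -pE; case: sp => ->; [left|right].
    by case=> ->//; exact: ltW.
  move=> /andP[]; rewrite le_eqVlt => /predU1P[<- _|pt]; first by apply: endp; left.
  rewrite le_eqVlt => /predU1P[->|tp]; first by apply: endp; right.
  by have /andP[_ /ltW] := pin t (introT andP (conj pt tp)).
have coordP t k : p.1 <= t <= p.2 -> `|x 0 k - g t 0 k| <= r'.
  by move=> pt; exact: le_trans (coord_le_edist _ _ _) (inball _ pt).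
pose f t := g (clamp (lo g) (hi g) t) 0 j.
have fE t : p.1 <= t <= p.2 -> f t = g t 0 j.
  by move=> /dom; rewrite /pcurve_dom/= in_itv/= => gt; rewrite /f clamp_id.
have pp1 : p.1 <= p.1 <= p.2 by rewrite lexx ltW.
have pp2 : p.1 <= p.2 <= p.2 by rewrite lexx ltW.
pose a := Num.min (f p.1) (f p.2) - (x 0 j - r').
have a0 : 0 <= a.
  have := coordP _ j pp1; have := coordP _ j pp2.
  by rewrite /a !ler_norml -!fE// minEle; case: ifP => _; lra.
(* The first grid level strictly above the lower end value; it exceeds that value by at most [h],
   hence does not pass the upper one. *)
pose m := (Num.truncn (a / h)).+1.
have /andP[ma am] : a < m%:R * h <= a + h.
  have /andP[h1 h2] := truncn_itv (divr_ge0 a0 (ltW h0)).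
  rewrite -ltr_pdivrMr// h2/= -ler_pdivlMr//.
  by rewrite mulrDl divff ?gt_eqF// /m -natr1 lerD2r.
have mmax : m%:R * h <= Num.max (f p.1) (f p.2) - (x 0 j - r').
  apply: le_trans am _; move: far; rewrite -!fE// -/h /a minEle maxEle.
  by case: ifP => f12; [rewrite distrC|]; rewrite ger0_norm; lra.
have [|||t] := @IVT R f p.1 p.2 (x 0 j - r' + m%:R * h).
- exact: ltW.
- apply: continuous_subspaceT; exact: continuous_coord.
- by move: ma mmax; rewrite /a; lra.
rewrite in_itv/= => pt ft; exists j, m, t; split=> //.
  apply: le_trans mmax _; have := coordP _ j pp1; have := coordP _ j pp2.
  by rewrite !ler_norml -!fE// maxEle; case: ifP => _; lra.
move=> k; rewrite mxE; have [->|kj] := eqVneq k j.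
  by rewrite /= -fE// ft; lra.
by have := coordP _ k pt; rewrite ler_norml /=; lra.
Qed.

(** [C] is chosen before the gauge: it is the number of faces times the content bound for one face
    of side [2 * r']. *)
Lemma crossing_cover x r r' : 0 < r -> r < r' ->
  exists C : R, forall gauge, (forall y, 0 < gauge y) ->
  exists s : seq ('rV[R]_d * R),
  [/\ forall q, q \in s -> 0 < q.2 < gauge q.1,
      forall g p, pcurve_crossings g x r r' p -> exists2 q, q \in s &
        exists t, p.1 <= t <= p.2 /\ edist q.1 (g t) <= q.2 &
      \sum_(q <- s) q.2 ^+ d.-1 <= C].
Proof.
move=> r0 rr'; pose h := (r' - r) / (2 * d%:R).
pose N := Num.bound (2 * r' / h).
pose I := [seq (j, m) | j <- enum 'I_d, m <- iota 0 N].
exists ((size I)%:R * (d%:R * (2 * r')) ^+ d.-1) => gauge gauge0.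
pose B (jm : 'I_d * nat) := face jm.1 (grid_corner x r' h jm.1 jm.2) (2 * r').
have [||s [sg sB sC]] := @gauge_cover_bigcup R d gauge _ I
    [set y | exists2 jm, jm \in I & B jm y] B ((d%:R * (2 * r')) ^+ d.-1).
- by [].
- by move=> jm _; apply: gauge_cover_face => //; lra.
exists s; split=> // g p gp.
have [j [m [t [mh pt gt]]]] := crossing_face r0 rr' gp.
have [|q qs qt] := sB (g t); last by exists q => //; exists t.
exists (j, m) => //; apply/allpairsP.
exists (j, m); split; [by rewrite mem_enum| |by []].
have h0 : 0 < h.
  by rewrite /h divr_gt0 ?subr_gt0// mulr_gt0// ltr0n (leq_ltn_trans _ (ltn_ord j)).
rewrite mem_iota add0n -(ltr_nat R).
have : 2 * r' / h < N%:R.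
  by apply: archi_boundP; rewrite divr_ge0 ?(ltW h0)// mulr_ge0// ltW// (lt_trans r0).
by apply: le_lt_trans; rewrite ler_pdivlMr.
Qed.

End CrossingCover.

(** * Measurability, monotonicity and union bound for the tails *)

Section Tails.
Context {R : realType} {d : nat}.
Implicit Types (M : set (path_measure R d)) (x : 'rV[R]_d) (r : R).
Local Open Scope ereal_scope.

Lemma ge_sup0 (A : set (\bar R)) y : 0 <= y -> (forall z, A z -> z <= y) -> sup0 A <= y.
Proof. by move=> y0 Ay; apply: ge_ereal_sup => z [->|/Ay]. Qed.

Lemma sup0_ge0 (A : set (\bar R)) : 0 <= sup0 A.
Proof. by apply: ereal_sup_ubound; left. Qed.

(** The event in [sup_tail], typed so that it carries the Borel sigma-algebra. *)
Definition tail_event x r r' (n : nat) :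
    set (g_sigma_algebraType (@path_coll_open R d)) :=
  [set G : path_coll R d | n%:R%:E <= ncross G x r r'].

(** Where the crossing number is below [n] it is finite, and semicontinuity keeps it below [n] on a
    ball; so the complement is open. *)
Lemma measurable_tail_event x r r' n : (r < r')%R -> measurable (tail_event x r r' n).
Proof.
move=> rr'; rewrite -[X in measurable X]setCK; apply: measurableC.
apply: sub_sigma_algebra => G /negP; rewrite -ltNge => GN.
have [|e e0 He] := @ncross_usc R d G x r r' rr'.
  by apply: lt_trans GN _; exact: ltry.
exists e => // G' /He G'G; apply/negP; rewrite -ltNge.
exact: le_lt_trans GN.
Qed.

Lemma sup_tail_le1 M x r r' n : (r < r')%R -> sup_tail M x r r' n <= 1.
Proof.
move=> rr'; apply: ge_sup0 => // _ [mu _ <-].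
by apply: probability_le1; exact: measurable_tail_event.
Qed.

Lemma sup_tail_nonincreasing M x r r' : (r < r')%R ->
  nonincreasing_seq (sup_tail M x r r').
Proof.
move=> rr' m n mn; apply: ge_sup0 => [|_ [mu Mmu <-]]; first exact: sup0_ge0.
apply: (@le_trans _ _ (mu (tail_event x r r' m))); last first.
  by apply: sup0_ge; exists mu.
apply: le_measure; [by apply: mem_set; exact: measurable_tail_event..|].
by move=> G; apply: le_trans; rewrite lee_fin ler_nat.
Qed.

Lemma is_cvg_sup_tail M x r r' : (r < r')%R -> cvgn (sup_tail M x r r').
Proof. by move=> rr'; exact/ereal_nonincreasing_is_cvgn/sup_tail_nonincreasing. Qed.

Lemma lim_sup_tail_ge0 M x r r' : (r < r')%R -> 0 <= limn (sup_tail M x r r').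
Proof.
move=> rr'; apply: lime_ge; first exact: is_cvg_sup_tail.
by apply: nearW => n; exact: sup0_ge0.
Qed.

(** Ensures that [fine] in the theorem loses no information. *)
Lemma lim_sup_tail_fin M x r r' : (r < r')%R ->
  limn (sup_tail M x r r') \is a fin_num.
Proof.
move=> rr'; rewrite ge0_fin_numE ?lim_sup_tail_ge0//.
apply: (@le_lt_trans _ _ 1); last exact: ltry.
apply: lime_le; first exact: is_cvg_sup_tail.
by apply: nearW => n; exact: sup_tail_le1.
Qed.

Lemma ncross_cover (G : path_coll R d) x r r' s (l : seq ('rV[R]_d * R)) :
  (r < r')%R -> (s <= (r' - r) / 2)%R -> (forall q, q \in l -> (q.2 < s)%R) ->
  (forall (g : @pcurve R d) p, pcurve_crossings g x r r' p -> exists2 q, q \in l &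
     exists t, (p.1 <= t <= p.2)%R /\ (edist q.1 (g t) <= q.2)%R) ->
  ncross G x r r' <= \sum_(q <- l) ncross G q.1 q.2 s.
Proof.
move=> rr' sr ls lcover; rewrite ncrossE.
under eq_bigr do rewrite ncrossE.
rewrite -esum_sum; last by move=> *; exact: curve_ncross_ge0.
by apply: le_esum => c _; apply: pcurve_ncross_cover => // p; exact: lcover.
Qed.

Lemma measure_bigsetU_seq disp (T : measurableType disp) (mu : {measure set T -> \bar R})
    (I : Type) (l : seq I) (B : I -> set T) : (forall i, measurable (B i)) ->
  mu (\big[setU/set0]_(i <- l) B i) <= \sum_(i <- l) mu (B i).
Proof.
move=> mB; elim: l => [|i l IHl]; first by rewrite !big_nil measure0.
rewrite !big_cons; apply: le_trans (measureU2 _ _ _) _ => //.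
  exact: bigsetU_measurable.
exact: leeD2l.
Qed.

(** Pigeonhole: if each annulus around a ball of [l] has at most [n] crossings, there are at most
    [size l * n] in total. The successor excludes this, and the union bound applies. *)
Lemma sup_tail_cover M x r r' s (l : seq ('rV[R]_d * R)) n :
  (r < r')%R -> (s <= (r' - r) / 2)%R -> (forall q, q \in l -> (q.2 < s)%R) ->
  (forall (g : @pcurve R d) p, pcurve_crossings g x r r' p -> exists2 q, q \in l &
     exists t, (p.1 <= t <= p.2)%R /\ (edist q.1 (g t) <= q.2)%R) ->
  sup_tail M x r r' (size l * n).+1 <= \sum_(q <- l) sup_tail M q.1 q.2 s n.
Proof.
move=> rr' sr ls lcover; apply: ge_sup0 => [|_ [mu Mmu <-]].
  by apply: sume_ge0 => q _; exact: sup0_ge0.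
apply: (@le_trans _ _ (\sum_(q <- l) mu (tail_event q.1 q.2 s n))); last first.
  by apply: lee_sum => q _; apply: sup0_ge; exists mu.
(* Measurability of the event uses [q.2 < s], known only on [l]; the union bound asks for it at
   every [q]. *)
pose B q := if q \in l then tail_event q.1 q.2 s n else set0.
have mB q : measurable (B q).
  by rewrite /B; case: ifP => // /ls; exact: measurable_tail_event.
rewrite big_seq (eq_bigr (fun q => mu (B q))); last by move=> q ql; rewrite /B ql.
rewrite -big_seq; apply: le_trans (measure_bigsetU_seq mu l mB).
apply: le_measure.
- by apply: mem_set; exact: measurable_tail_event.
- by apply: mem_set; exact: bigsetU_measurable.
move=> G NG; rewrite -bigcup_seq; apply: contrapT => nB.
have few q : q \in l -> ncross G q.1 q.2 s <= n%:R%:E.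
  move=> ql; rewrite leNgt; apply/negP => nq; apply: nB; exists q => //.
  by rewrite /B ql; exact: ltW.
suff : (size l * n).+1%:R%:E <= (size l * n)%:R%:E :> \bar R.
  by rewrite lee_fin ler_nat ltnn.
apply: le_trans NG (le_trans (ncross_cover G rr' sr ls lcover) _).
apply: (@le_trans _ _ (\sum_(q <- l) n%:R%:E)).
  by rewrite big_seq [leRHS]big_seq; apply: lee_sum.
by rewrite sumEFin big_const_seq count_predT iter_addr_0 -mulrnA mulnC.
Qed.

End Tails.

(** * Regularity and the decay of limiting tails at small inner radii *)

Theorem theorem1p6 (R : realType) (d : nat) (hd : (1 <= d)%N)
    (M : set (path_measure R d)) :
  regular M <->
  forall (x : 'rV[R]_d) (r' : R), 0 < r' ->
    (fun r : R => fine (limn (sup_tail M x r r')) : R^o)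
      =o_ (0^'+) (fun r : R => r ^+ d.-1 : R^o).
Proof.
split=> [Mreg x r' r'0|H x r r' r0 rr'].
  apply/eqoP => e e0; near=> r.
  have [r0 rr'] : 0 < r /\ r < r'.
    by split; near: r; [exact: nbhs_right_gt|exact: nbhs_right_lt].
  (* By regularity the limiting tail vanishes for every [r] in [(0, r')]. *)
  rewrite (cvg_lim _ (Mreg x r r' r0 rr'))// normr0 mulr_ge0//.
  exact: ltW.
suff lim0 : limn (sup_tail M x r r') = 0%E.
  by rewrite -lim0; exact: is_cvg_sup_tail.
have [C CP] := crossing_cover x r0 rr'.
pose s := (r' - r) / 2; have s0 : 0 < s by rewrite /s; lra.
apply/eqP; rewrite eq_le lim_sup_tail_ge0// andbT.
have small e : 0 < e -> (limn (sup_tail M x r r') <= (e * C)%:E)%E.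
  move=> e0.
  have /choice[gauge gaugeP] : forall y : 'rV[R]_d, exists rho, 0 < rho /\
      forall t, 0 < t < rho -> t < s /\
        (limn (sup_tail M y t s) <= (e * t ^+ d.-1)%:E)%E.
    (* The decay hypothesis is used at the point [y] with outer radius [s]; the minimum with [s]
       keeps inner radii below the outer one. *)
    move=> y; have /eqoP/(_ e e0) := H y s s0.
    move=> /nbhs_ballP[rho rho0 small_rho]; exists (Num.min rho s); split.
      by rewrite lt_min rho0.
    move=> t /andP[t0]; rewrite lt_min => /andP[trho ts]; split=> //.
    have := small_rho t; rewrite /= /ball/= sub0r normrN gtr0_norm// => /(_ trho t0).
    rewrite [X in _ * X]ger0_norm; last by rewrite exprn_ge0// ltW.
    move=> lim_le; rewrite -[leLHS]fineK ?lim_sup_tail_fin// lee_fin.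
    exact: le_trans (ler_norm _) lim_le.
  have [|l [lgauge lcover lC]] := CP gauge; first by move=> y; case: (gaugeP y).
  have ls q : q \in l -> q.2 < s.
    by move=> /lgauge ql; have [_ /(_ _ ql)[]] := gaugeP q.1.
  have tail_le n := sup_tail_cover M n rr' (lexx s) ls lcover.
  apply: (@le_trans _ _ (\sum_(q <- l) limn (sup_tail M q.1 q.2 s))%E); last first.
    apply: (@le_trans _ _ (\sum_(q <- l) (e * q.2 ^+ d.-1)%:E)%E).
      rewrite big_seq [leRHS]big_seq; apply: lee_sum => q ql.
      by have [_ /(_ _ (lgauge _ ql))[]] := gaugeP q.1.
    by rewrite sumEFin lee_fin -mulr_sumr ler_pM2l.
  have tail_cvg : (\sum_(q <- l) sup_tail M q.1 q.2 s n)%E @[n --> \oo] -->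
      (\sum_(q <- l) limn (sup_tail M q.1 q.2 s))%E.
    rewrite big_seq; under eq_cvg do rewrite big_seq.
    apply: cvg_nnesum => q ql; first by apply: nearW => n; exact: sup0_ge0.
    by apply: is_cvg_sup_tail; exact: ls.
  (* By monotonicity the limit is at most the term of index [(size l * n).+1], hence at most the sum
     of tails at [n]; then [n] tends to infinity. *)
  apply: (cvge_ge _ tail_cvg); apply: nearW => n; apply: le_trans (tail_le n).
  apply: lime_le; first exact: is_cvg_sup_tail.
  by near=> m; apply: sup_tail_nonincreasing => //; near: m; exact: nbhs_infty_ge.
apply/lee_addgt0Pr => e e0; rewrite add0e.
apply: le_trans (small (e / (`|C| + 1)) _) _.
  by rewrite divr_gt0// ltr_wpDl.
rewrite lee_fin -mulrA ler_piMr//; first exact: ltW.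
rewrite mulrC ler_pdivrMr ?ltr_wpDl// mul1r.
by rewrite (le_trans (ler_norm C))// lerDl.
Unshelve. all: by end_near. Qed.
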